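(* When the number of classes satisfies $K>2$, global top-label calibration of all members does not necessarily imply global top-label calibration of the ensemble. That is, for every integer $K>2$ there exist a finite labelled sample $\{(\boldsymbol{x}^{(i)},y^{(i)})\}_{i=1}^N$ with $y^{(i)}\in\{\omega_1,\dots,\omega_K\}$ and models $\boldsymbol{\theta}^{(1)},\dots,\boldsymbol{\theta}^{(M)}$ such that every member $\boldsymbol{\theta}^{(m)}$ is globally top-label calibrated on the sample, but the ensemble with prediction $P(\omega\mid\boldsymbol{x};\boldsymbol{\Theta})=\frac1M\sum_{m=1}^M P(\omega\mid\boldsymbol{x};\boldsymbol{\theta}^{(m)})$ is not globally top-label calibrated on the sample.
   Context: $\mathcal{X}\subseteq\mathbb{R}^d$ is the input space, with $\boldsymbol{x}^{(i)}\in\mathcal{X}$, and $\{\omega_1,\dots,\omega_K\}$ is the set of $K$ classes. A model $\boldsymbol{\theta}$ assigns to each $\boldsymbol{x}\in\mathcal{X}$ a probability distribution $P(\cdot\mid\boldsymbol{x};\boldsymbol{\theta})$ on the classes. $\delta(s,t)=1$ if $s=t$ and $0$ otherwise. Top labels: $\hat y^{(i)}_m=\arg\max_\omega P(\omega\mid\boldsymbol{x}^{(i)};\boldsymbol{\theta}^{(m)})$ for member $m$ and $\hat y^{(i)}_E=\arg\max_\omega \frac1M\sum_{m=1}^M P(\omega\mid\boldsymbol{x}^{(i)};\boldsymbol{\theta}^{(m)})$ for the ensemble (a maximizer). Global top-label calibration of a predictor $P(\cdot\mid\boldsymbol{x})$ (a member or the ensemble) with top labels $\hat y^{(i)}$ on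 the sample means $$\frac1N\sum_{i=1}^N P(\hat y^{(i)}\mid\boldsymbol{x}^{(i)})=\frac1N\sum_{i=1}^N\delta(y^{(i)},\hat y^{(i)}).$$ *)

(* Defs.v *)
From HB Require Import structures.
From mathcomp Require Import all_boot all_order all_algebra.
From mathcomp Require Import boolp classical_sets reals.

Set Implicit Arguments.
Unset Strict Implicit.
Unset Printing Implicit Defensive.

Import Order.TTheory GRing.Theory Num.Theory.
Local Open Scope ring_scope.

(* The classes omega_1, ..., omega_K are the elements of 'I_K. *)
Definition predictor (R : realType) (d : nat) (X : set 'rV[R]_d) (K : nat) :=
  X -> 'I_K -> R.

Record model (R : realType) (d : nat) (X : set 'rV[R]_d) (K : nat) := Model {
  model_prob :> X -> 'I_K -> R;
  model_prob_ge0 : forall (x : X) (w : 'I_K), 0 <= model_prob x w;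
  model_prob_sum1 : forall x : X, \sum_(w < K) model_prob x w = 1 }.

Definition ensemble (R : realType) (d : nat) (X : set 'rV[R]_d) (K M : nat)
    (theta : 'I_M -> model X K) : predictor X K :=
  fun x w => M%:R^-1 * \sum_(m < M) theta m x w.

(* yhat selects one maximizing class per sample point; ties may be broken
   arbitrarily, and differently at different indices i. *)
Definition top_labels (R : realType) (d : nat) (X : set 'rV[R]_d) (K N : nat)
    (P : predictor X K) (x : 'I_N -> X) (yhat : 'I_N -> 'I_K) : Prop :=
  forall (i : 'I_N) (w : 'I_K), P (x i) w <= P (x i) (yhat i).

Definition top_label_calibrated (R : realType) (d : nat) (X : set 'rV[R]_d)
    (K N : nat) (P : predictor X K) (x : 'I_N -> X) (y yhat : 'I_N -> 'I_K)
    : Prop :=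
  N%:R^-1 * \sum_(i < N) P (x i) (yhat i) =
  N%:R^-1 * \sum_(i < N) (y i == yhat i)%:R.

(* Main.v *)
(* Take two sample points at the same x, labelled 0 and 1, and two members
   predicting (1/2, 1/10, 2/5, 0, ...) and (1/10, 1/2, 2/5, 0, ...). Each member
   is right on half of the sample with confidence 1/2. Their average
   (3/10, 3/10, 2/5, 0, ...) has the new top label 2, which never occurs, but
   confidence 2/5. All maxima are strict, so tie-breaking plays no role. *)
Require Import Defs.
From HB Require Import structures.
From mathcomp Require Import all_boot all_order all_algebra.
From mathcomp Require Import boolp classical_sets reals.
From mathcomp Require Import lra.

Set Implicit Arguments.
Unset Strict Implicit.
Unset Printing Implicit Defensive.

Import Order.TTheory GRing.Theory Num.Theory.
Local Open Scope classical_set_scope.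
Local Open Scope ring_scope.

Section Witness.
Variables (R : realType) (d : nat) (X : set 'rV[R]_d) (k : nat).

(** Both indices are natural numbers, so that a class can be compared with a member: member [m]
    favours class [m]. *)
Definition witness_prob (m w : nat) : R :=
  if w == m then 2^-1 else
  if (w < 2)%N then 10^-1 else if w == 2 then 2 / 5 else 0.

Lemma witness_prob_ge0 (m w : nat) : 0 <= witness_prob m w.
Proof. by rewrite /witness_prob; do !case: ifP => _; lra. Qed.

Lemma witness_prob_sum1 (m : 'I_2) : \sum_(w < k.+3) witness_prob m w = 1.
Proof.
(* Unrolling splits off classes 0, 1, 2, which carry all the mass; the remaining sum over ['I_k]
   vanishes. *)
rewrite !big_ord_recl big1 => [|i _].
  by case: m => [[|[|m]] //= ?]; rewrite /witness_prob /=; lra.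
by case: m => [[|[|m]] //= ?]; rewrite /witness_prob.
Qed.

Definition witness (m : 'I_2) : model X k.+3 :=
  Model (fun (_ : X) (w : 'I_k.+3) => witness_prob_ge0 m w)
        (fun _ : X => witness_prob_sum1 m).

(** Comparison with class [m] alone suffices: it has 1/2, and every other class at most 2/5. *)
Lemma witness_top (m : 'I_2) (x : X) (v : 'I_k.+3) :
  (forall w, witness m x w <= witness m x v) -> v = m :> nat.
Proof.
move/(_ (widen_ord (isT : (2 <= k.+3)%N) m)); rewrite /= /witness_prob eqxx.
by case: eqP => // _ vmax; exfalso; move: vmax; do 2?case: ifP => _; lra.
Qed.

Lemma ensemble_witnessE (x : X) (w : 'I_k.+3) :
  ensemble witness x w =
  if (w < 2)%N then 3 / 10 else if w == 2 :> nat then 2 / 5 else 0.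
Proof.
rewrite /ensemble !big_ord_recl big_ord0 /= /witness_prob /=.
by case: w => [[|[|[|w]]] /= _]; lra.
Qed.

(** Class 2 has 2/5, while any other class has 3/10 or 0. *)
Lemma ensemble_witness_top (x : X) (v : 'I_k.+3) :
  (forall w, ensemble witness x w <= ensemble witness x v) -> v = 2 :> nat.
Proof.
move/(_ (Ordinal (isT : (2 < k.+3)%N))); rewrite !ensemble_witnessE /=.
by case: eqP => // _ vmax; exfalso; move: vmax; case: ifP => _; lra.
Qed.

End Witness.

Theorem proposition4 (R : realType) (d : nat) (X : set 'rV[R]_d)
    (X_neq0 : X !=set0) (K : nat) (K_gt2 : (2 < K)%N) :
  exists (N : nat) (x : 'I_N -> X) (y : 'I_N -> 'I_K)
         (M : nat) (theta : 'I_M -> model X K),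
    [/\ (0 < N)%N, (0 < M)%N &
      forall (yhat : 'I_M -> 'I_N -> 'I_K) (yhatE : 'I_N -> 'I_K),
        (forall m : 'I_M, top_labels (theta m) x (yhat m)) ->
        top_labels (ensemble theta) x yhatE ->
        (forall m : 'I_M, top_label_calibrated (theta m) x y (yhat m)) /\
        ~ top_label_calibrated (ensemble theta) x y yhatE].
Proof.
case: K K_gt2 => [|[|[|k]]] // _; case: X_neq0 => x0 Xx0.
have xX : x0 \in X by rewrite inE.
pose x (_ : 'I_2) : X := SigSub xX.
(* Point [i] gets label [i], so member [m] is right exactly at [i = m]. *)
pose y : 'I_2 -> 'I_k.+3 := widen_ord (isT : (2 <= k.+3)%N).
exists 2, x, y, 2, (@witness R d X k); split=> // yhat yhatE top topE.
split=> [m|].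
  have yhatm i : yhat m i = m :> nat by apply: witness_top (top m i).
  rewrite /top_label_calibrated !big_ord_recl !big_ord0 /= /witness_prob.
  (* Equality of classes is moved to [nat], where [yhatm] determines the top labels. *)
  rewrite -!val_eqE /= !yhatm eqxx.
  by case: m {yhatm} => [[|[|m]] //= ?]; lra.
have yhatE2 i : yhatE i = 2 :> nat by apply: ensemble_witness_top (topE i).
(* Calibration would now read 2/5 = 0. *)
rewrite /top_label_calibrated !big_ord_recl !big_ord0 !ensemble_witnessE.
by rewrite -!val_eqE /= !yhatE2 /=; lra.
Qed.
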